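(* Let $\mathrm{2RR}=\textsc{RoundRobin}(\mathrm{ALG}_{\mathrm{fail}},\mathrm{ALG}_{\mathrm{succ}};1,1)$. Then for every instance $I$ of Stochastic Score Classification, $$\mathbb{E}[\mathrm{cost}(\mathrm{2RR},I)]\le 6\cdot \mathbb{E}[\mathrm{cost}(\mathrm{OPT},I)],$$ i.e., $\mathrm{2RR}$ is a 6-approximation algorithm for SSC.
   Context: An instance $I$ of Stochastic Score Classification (SSC) consists of tests $N=\{1,\dots,n\}$, costs $c_j\ge 0$, success probabilities $p_j\in(0,1)$, and integers $0=t_1<t_2<\dots<t_B<t_{B+1}=n+1$. The outcome vector $x\in\{0,1\}^N$ has independent coordinates with $\Pr[x_j=1]=p_j$ (test $j$ succeeds iff $x_j=1$, otherwise it fails). The score $f(x)$ is the unique $i\in\{1,\dots,B\}$ with $t_i\le\|x\|_1\le t_{i+1}-1$. A (possibly adaptive) strategy conducts tests one at a time, each at most once, the choice of the next test possibly depending on outcomes observed so far, and stops as soon as $f(x)$ is determined (i.e., all $x'\in\{0,1\}^N$ agreeing with $x$ on the conducted tests have $f(x')=f(x)$). $\mathrm{cost}(S,I)$ is the random total cost of the tests conducted by strategy $S$ on $I$. $\mathrm{OPT}$ is a fixed strategy minimizing $\mathbb{E}[\mathrm{cost}(S,I)]$ over all adaptive strategies $S$. Let $\sigma_{\mathrm{fail}},\sigma_{\mathrm{succ}}$ be permutations of $N$ (ties broken arbitrarily) such that $c_{\sigma_{\mathrm{fail}}(1)}/(1-p_{\sigma_{\mathrm{fail}}(1)})\le\dots\le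 c_{\sigma_{\mathrm{fail}}(n)}/(1-p_{\sigma_{\mathrm{fail}}(n)})$ and $c_{\sigma_{\mathrm{succ}}(1)}/p_{\sigma_{\mathrm{succ}}(1)}\le\dots\le c_{\sigma_{\mathrm{succ}}(n)}/p_{\sigma_{\mathrm{succ}}(n)}$. $\mathrm{ALG}_{\mathrm{fail}},\mathrm{ALG}_{\mathrm{succ}}$ denote the orders of tests given by $\sigma_{\mathrm{fail}},\sigma_{\mathrm{succ}}$. $\textsc{RoundRobin}(\mathrm{ALG}_1,\dots,\mathrm{ALG}_k;\alpha_1,\dots,\alpha_k)$, for fixed orders $\mathrm{ALG}_h$ of $N$ and weights $\alpha_h>0$: initialize $C_h=0$ for all $h$; while $f(x)$ is not determined, for each $h$ let $\delta_h$ be the cost of the first test in the order $\mathrm{ALG}_h$ that has not yet been conducted by the scheme, choose $h^\star\in\arg\min_h (C_h+\delta_h)/\alpha_h$ (ties arbitrary), conduct that test of $\mathrm{ALG}_{h^\star}$, and set $C_{h^\star}\leftarrow C_{h^\star}+\delta_{h^\star}$. *)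

(* Defs.v *)
From mathcomp Require Import all_boot all_order all_algebra all_fingroup.
Set Implicit Arguments. Unset Strict Implicit. Unset Printing Implicit Defensive.
Import Order.TTheory GRing.Theory Num.Theory.
Local Open Scope ring_scope.

(* Outcome vector x in {0,1}^N  (true = test succeeds). *)
Definition outcome (n : nat) := {ffun 'I_n -> bool}.
(* Observed information: None = test not conducted, Some b = outcome b seen. *)
Definition partial (n : nat) := {ffun 'I_n -> option bool}.

Definition empty_partial (n : nat) : partial n := [ffun _ => None].

Definition consistent (n : nat) (x : outcome n) (q : partial n) : bool :=
  [forall j, (q j == None) || (q j == Some (x j))].

Definition ones (n : nat) (x : outcome n) : nat := #|[set j | x j]|.

(* The score classes are i = 1..B with t_i <= s <= t_{i+1} - 1.
   same_score t B s s' : scores s and s' lie in the same class. *)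
Definition same_score (t : nat -> nat) (B : nat) (s s' : nat) : bool :=
  all (fun i => ((t i <= s < t i.+1)%N) == ((t i <= s' < t i.+1)%N)) (iota 1 B).

Definition determined (n : nat) (t : nat -> nat) (B : nat) (q : partial n) : bool :=
  [forall x : outcome n, forall x' : outcome n,
     (consistent x q && consistent x' q) ==> same_score t B (ones x) (ones x')].

Definition reveal (n : nat) (x : outcome n) (q : partial n) (j : 'I_n) : partial n :=
  [ffun k => if k == j then Some (x j) else q k].

Definition tested_cost (R : nmodType) (n : nat) (c : 'I_n -> R) (q : partial n) : R :=
  \sum_(j | q j != None) c j.

Definition prob (R : pzRingType) (n : nat) (p : 'I_n -> R) (x : outcome n) : R :=
  \prod_j (if x j then p j else 1 - p j).

Definition expectation (R : pzRingType) (n : nat) (p : 'I_n -> R)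
  (F : outcome n -> R) : R :=
  \sum_(x : outcome n) prob p x * F x.

Definition strategy (n : nat) := partial n -> 'I_n.

Definition valid_strategy (n : nat) (t : nat -> nat) (B : nat) (S : strategy n) : Prop :=
  forall q : partial n, ~~ determined t B q -> q (S q) = None.

Fixpoint run_strategy (n : nat) (t : nat -> nat) (B : nat) (S : strategy n)
  (x : outcome n) (k : nat) (q : partial n) : partial n :=
  match k with
  | 0 => q
  | k'.+1 => if determined t B q then q
             else run_strategy t B S x k' (reveal x q (S q))
  end.

Definition cost_strategy (R : nmodType) (n : nat) (t : nat -> nat) (B : nat)
  (c : 'I_n -> R) (S : strategy n) (x : outcome n) : R :=
  tested_cost c (run_strategy t B S x n (empty_partial n)).

Definition first_untested (n : nat) (sigma : 'I_n -> 'I_n) (q : partial n)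
  : option 'I_n :=
  ohead [seq j <- [seq sigma i | i <- enum 'I_n] | q j == None].

(* state: observations q, counters C1 C2; ties broken by the (arbitrary)
   rule tb (true = choose ALG_1), depending on the observations so far *)
Fixpoint run_rr2 (R : numDomainType) (n : nat) (t : nat -> nat) (B : nat)
  (c : 'I_n -> R) (s1 s2 : 'I_n -> 'I_n) (tb : partial n -> bool)
  (x : outcome n) (k : nat) (q : partial n) (C1 C2 : R) : partial n :=
  match k with
  | 0 => q
  | k'.+1 =>
    if determined t B q then q else
    match first_untested s1 q, first_untested s2 q with
    | Some j1, Some j2 =>
        let v1 := (C1 + c j1) / 1 in
        let v2 := (C2 + c j2) / 1 in
        if (v1 < v2) || ((v1 == v2) && tb q)
        then run_rr2 t B c s1 s2 tb x k' (reveal x q j1) (C1 + c j1) C2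
        else run_rr2 t B c s1 s2 tb x k' (reveal x q j2) C1 (C2 + c j2)
    | _, _ => q
    end
  end.

Definition cost_rr2 (R : numDomainType) (n : nat) (t : nat -> nat) (B : nat)
  (c : 'I_n -> R) (s1 s2 : 'I_n -> 'I_n) (tb : partial n -> bool)
  (x : outcome n) : R :=
  tested_cost c (run_rr2 t B c s1 s2 tb x n (empty_partial n) 0 0).

Definition sorted_by (R : numDomainType) (n : nat) (r : 'I_n -> R)
  (sigma : {perm 'I_n}) : Prop :=
  forall i j : 'I_n, (i <= j)%N -> r (sigma i) <= r (sigma j).

(* Main.v *)
Require Import Defs.
From mathcomp Require Import all_boot all_order all_algebra all_fingroup.
From mathcomp Require Import zify ring lra.
Import Order.TTheory GRing.Theory Num.Theory.
Local Open Scope ring_scope.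
Set Implicit Arguments. Unset Strict Implicit. Unset Printing Implicit Defensive.

(* Fix a score class [t_i, t_{i+1}). To stop, one needs a = t_i successes and
   m = n + 1 - t_{i+1} failures. Let V_succ (V_fail) be the cost at which ALG_succ
   (ALG_fail) alone has seen a successes (m failures). While a goal is open, the next
   test of its list keeps the counter of that list within V_succ or V_fail, so both
   counters of 2RR stay below V_succ + V_fail. Hence it suffices to show
   E[V_succ + V_fail] <= 3 E[OPT] on each class.
   Let D be the r = a + m - 1 cheapest tests. Any strategy conducts at least r tests, so
   c(D) <= OPT pointwise. An exchange argument shows that, in expectation on the class,
   V_succ is at most the cost of conducting D first and then the remaining tests in the
   order ALG_succ: ordering by c/p alone is not optimal once the class bounds the
   score from above, but bubbling cheap tests behind more expensive ones with a better
   ratio always helps. After D at most one goal is still open. If the success goal is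
   open, the failure goal is reached, so the class has become the upper tail
   ||x|| >= a, for which ALG_succ on the remaining tests is optimal even among adaptive
   strategies. So V_succ <= c(D) + OPT [success goal open after D] in expectation, and
   the two brackets are disjoint. *)

(** * Counting the outcomes of one polarity in a set of tests *)

Section Hits.
Variable n : nat.
Implicit Types (x : outcome n) (A : {set 'I_n}) (j : 'I_n) (s : bool).

(* The polarity [s] selects successes or failures: the two orders are symmetric. *)
Definition hits s x A : nat := #|[set j in A | x j == s]|.

Definition upd x j (v : bool) : outcome n := [ffun k => if k == j then v else x k].

Lemma hits_sub s x A A' : A \subset A' -> (hits s x A <= hits s x A')%N.
Proof.
move=> sub; apply/subset_leq_card/subsetP => k; rewrite !inE => /andP[kA ->].
by rewrite (subsetP sub).
Qed.

Lemma hitsU1 s x A j : j \notin A -> hits s x (j |: A) = ((x j == s) + hits s x A)%N.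
Proof.
move=> jA; rewrite /hits; case: eqP => xj.
  rewrite (_ : [set k in j |: A | _] = j |: [set k in A | x k == s]).
    by rewrite cardsU1 inE (negPf jA).
  by apply/setP => k; rewrite !inE; case: (k =P j) => // ->; rewrite xj eqxx.
congr #|pred_of_set _|; apply/setP => k; rewrite !inE; case: (k =P j) => // ->.
by rewrite (negPf jA); apply/eqP.
Qed.

Lemma hitsD1 s x A j : j \in A -> hits s x A = ((x j == s) + hits s x (A :\ j))%N.
Proof. by move=> jA; rewrite -{1}(setD1K jA) hitsU1 // setD11. Qed.

Lemma eq_hits s (x y : outcome n) A : {in A, x =1 y} -> hits s x A = hits s y A.
Proof.
move=> e; congr #|pred_of_set _|; apply/setP => k; rewrite !inE.
by case kA: (k \in A) => //=; rewrite e.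
Qed.

Lemma hits_upd s x A j v : j \notin A -> hits s (upd x j v) A = hits s x A.
Proof.
move=> jA; apply: eq_hits => k kA; rewrite ffunE; case: eqP => // e.
by rewrite -e kA in jA.
Qed.

Lemma hitsN s x A : (hits s x A + hits (~~ s) x A)%N = #|A|.
Proof.
rewrite -(cardsID [set k | x k == s] A); congr (_ + _)%N; congr #|pred_of_set _|.
  by apply/setP => k; rewrite !inE.
by apply/setP => k; rewrite !inE andbC; case: s; case: (x k).
Qed.

Lemma hits_ones x : hits true x setT = ones x.
Proof. by congr #|pred_of_set _|; apply/setP => k; rewrite !inE eqb_id. Qed.

End Hits.

(** * Expectation over independent outcomes *)

Section Expectation.
Variables (R : realFieldType) (n : nat) (p : 'I_n -> R).
Implicit Types (F G : outcome n -> R) (j : 'I_n).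
Hypothesis p01 : forall j, 0 < p j < 1.

Definition bias (s : bool) j := if s then p j else 1 - p j.

Lemma bias_gt0 s j : 0 < bias s j.
Proof. by case: s => /=; rewrite ?subr_gt0; case/andP: (p01 j). Qed.

Lemma biasN s j : bias (~~ s) j = 1 - bias s j.
Proof. by case: s => //=; rewrite opprB addrC subrK. Qed.

Lemma prob_ge0 x : 0 <= prob p x.
Proof. by apply: prodr_ge0 => j _; exact: (ltW (bias_gt0 (x j) j)). Qed.

Lemma ler_exp F G : (forall x, F x <= G x) -> expectation p F <= expectation p G.
Proof. by move=> FG; apply: ler_sum => x _; rewrite ler_wpM2l ?prob_ge0. Qed.

Lemma eq_exp F G : F =1 G -> expectation p F = expectation p G.
Proof. by move=> FG; apply: eq_bigr => x _; rewrite FG. Qed.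

Lemma expD F G : expectation p (fun x => F x + G x) = expectation p F + expectation p G.
Proof. by rewrite -big_split; apply: eq_bigr => x _; rewrite mulrDr. Qed.

Lemma expB F G : expectation p (fun x => F x - G x) = expectation p F - expectation p G.
Proof. by rewrite -sumrB; apply: eq_bigr => x _; rewrite mulrBr. Qed.

Lemma exp_sum (I : Type) (l : seq I) (F : I -> outcome n -> R) :
  expectation p (fun x => \sum_(i <- l) F i x) = \sum_(i <- l) expectation p (F i).
Proof. by rewrite exchange_big; apply: eq_bigr => x _; rewrite mulr_sumr. Qed.

Lemma expZ k F : expectation p (fun x => k * F x) = k * expectation p F.
Proof. by rewrite mulr_sumr; apply: eq_bigr => x _; rewrite mulrCA. Qed.

Lemma upd_upd x j u v : upd (upd x j u) j v = upd x j v.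
Proof. by apply/ffunP => k; rewrite !ffunE; case: eqP. Qed.

(** Conditioning on test [j]: by independence its outcome can be resampled with the others fixed. *)
Lemma exp_upd s j F :
  expectation p F =
  expectation p (fun x => bias s j * F (upd x j s) + bias (~~ s) j * F (upd x j (~~ s))).
Proof.
pose P x := \prod_(k | k != j) bias (x k) k.
have PE x : prob p x = bias (x j) j * P x by rewrite /prob (bigD1 j).
have PU x v : P (upd x j v) = P x.
  by apply: eq_bigr => k kj; rewrite ffunE (negPf kj).
(* Outcomes that differ only at [j] are paired; the member with value [s] represents the pair. *)
have fold G : expectation p G = \sum_(x : outcome n | x j == s)
    P x * (bias s j * G (upd x j s) + bias (~~ s) j * G (upd x j (~~ s))).
  rewrite /expectation (bigID (fun x : outcome n => x j == s)) /=.
  rewrite [X in _ + X = _](reindex_onto (fun x => upd x j (~~ s))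
    (fun x => upd x j s)) /=; last first.
    move=> x xj; apply/ffunP => k; rewrite !ffunE; case: eqP => // ->.
    by move: xj; case: (x j); case: (s).
  under [X in _ + X = _]eq_bigl => x.
    rewrite ffunE eqxx (_ : ~~ (~~ s == s)); last by case: (s).
    rewrite upd_upd (_ : (upd x j s == x) = (x j == s)); last first.
      apply/eqP/eqP => [<-|<-]; first by rewrite ffunE eqxx.
      by apply/ffunP => k; rewrite ffunE; case: eqP => // ->.
    over.
  rewrite -big_split; apply: eq_bigr => x /= /eqP xj.
  rewrite !PE PU xj ffunE eqxx (_ : upd x j s = x); first by ring.
  by apply/ffunP => k; rewrite ffunE; case: eqP => // ->.
rewrite !fold; apply: eq_bigr => x _; rewrite !upd_upd biasN; ring.
Qed.

End Expectation.

(** * Exchange arguments for fixed orders of tests *)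

Section OrderCost.
Variables (R : realFieldType) (n : nat) (c p : 'I_n -> R) (s : bool) (a b : nat).
Implicit Types (x : outcome n) (A : {set 'I_n}) (i j : 'I_n) (l : seq 'I_n).
Hypothesis c_ge0 : forall j, 0 <= c j.
Hypothesis p01 : forall j, 0 < p j < 1.

(* Cost of conducting [l] until the goal of [a] outcomes equal to [s] is reached,
   the outcomes of the tests in [A] being known for free. *)
Fixpoint goal_cost A l x : R :=
  if l is j :: l' then (if (hits s x A < a)%N then c j else 0) + goal_cost (j |: A) l' x
  else 0.

Lemma goal_cost_ge0 A l x : 0 <= goal_cost A l x.
Proof.
by elim: l A => //= j l IH A; apply: addr_ge0 => //; case: ifP.
Qed.

Lemma goal_cost_cat A l1 l2 x :
  goal_cost A (l1 ++ l2) x = goal_cost A l1 x + goal_cost (A :|: [set j in l1]) l2 x.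
Proof.
elim: l1 A => [|j l1 IH] A /=; first by rewrite add0r set_nil setU0.
by rewrite IH addrA set_cons setUCA setUA.
Qed.

Lemma goal_cost_reached A l x : (a <= hits s x A)%N -> goal_cost A l x = 0.
Proof.
elim: l A => //= j l IH A aA; rewrite ltnNge aA /= add0r IH //.
by apply: leq_trans aA _; apply: hits_sub; exact: subsetUr.
Qed.

Lemma goal_cost_le A l x : goal_cost A l x <= \sum_(j <- l) c j.
Proof.
elim: l A => [|j l IH] A /=; first by rewrite big_nil.
by rewrite big_cons lerD //; case: ifP.
Qed.

(** Used as a 0/1 weight, so that no conditional expectation on a score class is needed. *)
Definition in_class x : R := (a <= hits s x setT < b)%N%:R.

(* Both orders cost the same unless exactly one [s] is missing after the tests in
   [A]. For two [s] outcomes the weight at [x] may drop because [b] is reached: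
   this is harmless if [i] is the cheaper test. *)
Lemma goal_cost_swap A l i j (w : outcome n -> R) :
  i != j -> i \notin A -> j \notin A -> (forall x, 0 <= w x) ->
  (forall x v, w (upd x i v) = w x) -> (forall x v, w (upd x j v) = w x) ->
  c j / bias p s j <= c i / bias p s i ->
  (c i <= c j \/ forall x, w x != 0 -> (hits s x setT < b)%N) ->
  expectation p (fun x => in_class x * w x * goal_cost A (j :: i :: l) x) <=
  expectation p (fun x => in_class x * w x * goal_cost A (i :: j :: l) x).
Proof.
move=> ij iA jA w0 wi wj; rewrite ler_pdivrMr ?bias_gt0 // mulrAC ler_pdivlMr ?bias_gt0 //.
move=> ratio side; rewrite -subr_ge0 -expB.
rewrite (exp_upd p s i) (exp_upd p s j) /expectation.
apply: sumr_ge0 => z _; apply: mulr_ge0; first exact: prob_ge0.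
have ji : j != i by rewrite eq_sym.
pose m := hits s z (setT :\ i :\ j); pose v := hits s z A.
have vm : (v <= m)%N.
  apply: hits_sub; apply/subsetP => k kA; rewrite !inE andbT.
  by apply/andP; split; apply: contraTneq kA => ->.
(* If [v >= a], neither order pays for [i] or [j]; if [v.+1 < a], both pay for both. If [v.+1 = a],
   a hit in the first test saves the second one. *)
have diff u1 u2 : let x := upd (upd z j u2) i u1 in
    in_class x * w x * goal_cost A (i :: j :: l) x
     - in_class x * w x * goal_cost A (j :: i :: l) x =
    (v.+1 == a)%:R * (a <= (u1 == s) + (u2 == s) + m < b)%N%:R * w z *
      ((u2 == s)%:R * c i - (u1 == s)%:R * c j).
  rewrite /= wi wj (setUCA [set i]) /in_class.
  rewrite (@hitsD1 _ _ _ setT i) ?inE // (@hitsD1 _ _ _ (_ :\ i) j) ?inE ?ji //.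
  rewrite !hitsU1 // !hits_upd ?inE ?eqxx ?andbF ?(negPf ij) // -/m -/v.
  rewrite !ffunE !eqxx (negPf ji) /= addnA.
  rewrite -mulrBr (mulrC (v.+1 == a)%:R) (mulrAC _ (v.+1 == a)%:R) -[RHS]mulrA.
  congr (_ * _); move: (goal_cost _ _ _) => K.
  have -> : (v.+1 == a) = (v < a)%N && ~~ (1 + v < a)%N by lia.
  have : (1 + v < a)%N -> (v < a)%N by lia.
  by case: (u1 == s) (u2 == s) => [] []; rewrite /= ?add0n;
    case: (1 + v < a)%N (v < a)%N => [] [] //=; try (move=> /(_ isT)); move=> // _; ring.
rewrite !diff.
have -> : (~~ s == s) = false by case: (s).
rewrite eqxx /=.
case: eqP => [va|_]; last by rewrite !(mul0r, mulr0, addr0).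
(* As [a = v.+1 <= m.+1], one hit among [i] and [j] already ensures the lower bound of the class. *)
have -> : (a <= 1 + 1 + m < b)%N = (2 + m < b)%N by lia.
have -> : (a <= 1 + 0 + m < b)%N = (1 + m < b)%N by lia.
have [wz|wz] := eqVneq (w z) 0; first by rewrite wz !(mul0r, mulr0, addr0).
have := bias_gt0 p01 s i; have := bias_gt0 p01 s j.
have := bias_gt0 p01 (~~ s) i; have := bias_gt0 p01 (~~ s) j.
rewrite !biasN; move: (bias p s i) (bias p s j) ratio => pi pj ratio pj1 pi1 pj0 pi0.
rewrite !(mul0r, mulr0, addr0, mul1r, subr0, sub0r, add0r, subrr).
have wz0 := w0 z.
have gain : 0 <= w z * (c i * pj - c j * pi) by rewrite mulr_ge0 // subr_ge0.
case b1 : (1 + m < b)%N; last first.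
  have -> : (2 + m < b)%N = false by apply: contraFF b1 => /ltnW.
  by rewrite !(mul0r, mulr0, addr0).
case b2 : (2 + m < b)%N; first by rewrite
    [X in 0 <= X](_ : _ = w z * (c i * pj - c j * pi)) // /=; ring.
(* Here two hits leave the class. Their lost contribution is a multiple of [c i - c j], so losing it
   does no harm if [c i <= c j]; the other alternative of [side] excludes this case. *)
case: side => [cij|/(_ (upd (upd z j s) i s))].
  rewrite [X in 0 <= X](_ : _ = w z * (c i * pj - c j * pi) + w z * (pi * pj * (c j - c i))).
    by rewrite addr_ge0 // !mulr_ge0 ?subr_ge0 // ltW.
  rewrite /=; ring.
rewrite wi wj wz => /(_ isT).
rewrite (@hitsD1 _ _ _ setT i) ?inE // (@hitsD1 _ _ _ (_ :\ i) j) ?inE ?ji //.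
by rewrite !hits_upd ?inE ?eqxx ?andbF // !ffunE !eqxx (negPf ji) eqxx addnA -/m b2.
Qed.

(** Adjacent swaps move [i] past [l1] one test at a time. The weight [w] must ignore the swapped
    tests; it later encodes what a strategy has observed. *)
Lemma goal_cost_insert A l1 l2 i (w : outcome n -> R) :
  {in l1, forall j, [/\ j != i, j \notin A, forall x v, w (upd x j v) = w x,
     c j / bias p s j <= c i / bias p s i &
     c i <= c j \/ forall x, w x != 0 -> (hits s x setT < b)%N]} ->
  uniq l1 -> i \notin A -> (forall x, 0 <= w x) -> (forall x v, w (upd x i v) = w x) ->
  expectation p (fun x => in_class x * w x * goal_cost A (l1 ++ i :: l2) x) <=
  expectation p (fun x => in_class x * w x * goal_cost A (i :: l1 ++ l2) x).
Proof.
move=> l1P ul1 iA w0 wi; elim: l1 l2 A ul1 iA l1P => //= j l1 IH l2 A /andP[jl1 ul1] iA l1P.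
have [ji jA wj ratio side] := l1P j (mem_head _ _).
apply: le_trans (goal_cost_swap (l1 ++ l2) _ _ _ _ _ _ _ _) => //; last by rewrite eq_sym.
have split l : expectation p (fun x => in_class x * w x * goal_cost A (j :: l) x) =
   expectation p (fun x => in_class x * w x * (if (hits s x A < a)%N then c j else 0))
   + expectation p (fun x => in_class x * w x * goal_cost (j |: A) l x).
  by rewrite -expD; apply: eq_exp => x; rewrite -mulrDr.
rewrite !split lerD2l.
apply: IH => //; first by rewrite !inE negb_or eq_sym ji.
move=> k kl1; have [|ki kA wk rk sk] := l1P k; first by rewrite inE kl1 orbT.
split=> //; rewrite !inE negb_or kA andbT.
by apply: contraNneq jl1 => <-.
Qed.

Lemma take_cheapest (C : seq 'I_n) d0 k j : pairwise (fun i j => c i <= c j) C ->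
  (k < size C)%N -> j \in C -> j \notin take k C -> c (nth d0 C k) <= c j.
Proof.
move=> sC kC; rewrite -{1}(cat_take_drop k C) mem_cat => + /negPf jD.
rewrite jD (drop_nth d0) //= inE => /predU1P[-> //|jd].
have /subseq_pairwise /(_ sC) : subseq (drop k C) C by exact: drop_subseq.
by rewrite (drop_nth d0) //= => /andP[/allP /(_ _ jd)].
Qed.

(* [L] is the order by ratio and [C] the order by cost. Sorting the cheapest tests
   back into [L] only moves cheap tests behind more expensive ones. *)
Lemma goal_cost_cheapest_first (L C : seq 'I_n) k :
  uniq L -> uniq C -> C =i L ->
  pairwise (fun i j => c i / bias p s i <= c j / bias p s j) L ->
  pairwise (fun i j => c i <= c j) C ->
  expectation p (fun x => in_class x * goal_cost set0 L x) <=
  expectation p (fun x => in_class x *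
    goal_cost set0 (take k C ++ [seq j <- L | j \notin take k C]) x).
Proof.
move=> uL uC CL sL sC; elim: k => [|k IH].
  by rewrite take0 /= (eq_filter (a2 := predT)) ?filter_predT // => j; rewrite in_nil.
have [kC|kC] := ltnP k (size C); last first.
  suff -> : take k.+1 C = take k C by [].
  by rewrite !take_oversize // ltnW.
apply: le_trans IH _.
case: C => [//|d0 C'] in uC CL sC kC *; move: (d0 :: C') => C in uC CL sC kC *.
(* The next cheapest test [d] stands somewhere in [E], the order behind [D]. Moving it from the
   front of [E] back to that place is an insertion past tests that cost at least [c d]. *)
pose d := nth d0 C k; set D := take k C.
have takeS : take k.+1 C = rcons D d by rewrite -take_nth.
have dD : d \notin D.
  by move: (take_uniq k.+1 uC); rewrite takeS rcons_uniq => /andP[].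
have dL : d \in L by rewrite -CL mem_nth.
have dmin j : j \in L -> j \notin D -> c d <= c j.
  by rewrite -CL; exact: take_cheapest.
rewrite takeS; set E := [seq j <- L | j \notin D].
have -> : [seq j <- L | j \notin rcons D d] = [seq j <- E | j != d].
  by rewrite -filter_predI; apply: eq_filter => j; rewrite /= mem_rcons inE negb_or.
have dE : d \in E by rewrite mem_filter dD.
have uE : uniq E by exact: filter_uniq.
have sE : pairwise (fun i j => c i / bias p s i <= c j / bias p s j) E.
  exact: subseq_pairwise (filter_subseq _ _) sL.
have ED j : j \in E -> j \in L /\ j \notin D by rewrite mem_filter => /andP[].
case/splitPr: dE uE sE ED => l1 l2.
rewrite cat_uniq /= negb_or pairwise_cat /= -andbA.
move=> /and4P[ul1 dl1 _ /andP[dl2 _]] /and3P[rl1 _ _] ED.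
have -> : [seq j <- l1 ++ d :: l2 | j != d] = l1 ++ l2.
  rewrite filter_cat /= eqxx; congr (_ ++ _); apply/all_filterP/allP => j jl.
    by apply: contraNneq dl1 => <-.
  by apply: contraNneq dl2 => <-.
rewrite cat_rcons.
have split l : expectation p (fun x => in_class x * goal_cost set0 (D ++ l) x) =
    expectation p (fun x => in_class x * goal_cost set0 D x) +
    expectation p (fun x => in_class x * 1 * goal_cost [set j in D] l x).
  rewrite -expD; apply: eq_exp => x; rewrite goal_cost_cat mulrDr mulr1.
  by rewrite set0U.
rewrite !split lerD2l; apply: goal_cost_insert => //; last by rewrite inE.
move=> j jl1; have [|jL jD] := ED j; first by rewrite mem_cat jl1.
split=> //; first by apply: contraNneq dl1 => <-.
- by rewrite inE.
- by have /allrelP := rl1; apply; rewrite ?inE ?eqxx.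
- by left; apply: dmin.
Qed.

End OrderCost.

(** * Optimality of the ratio order against adaptive strategies *)

Section Adaptive.
Variables (R : realFieldType) (n : nat) (c p : 'I_n -> R) (s : bool) (a b : nat).
Variables (t : nat -> nat) (B : nat).
Implicit Types (x : outcome n) (q : partial n) (A D : {set 'I_n}) (i j : 'I_n).
Hypothesis c_ge0 : forall j, 0 <= c j.
Hypothesis p01 : forall j, 0 < p j < 1.

Definition tested q : {set 'I_n} := [set j | q j != None].

(** Unlike [reveal], this takes the bare result, so that a run can be split by the result of a
    test. *)
Definition observe q j v : partial n := [ffun k => if k == j then Some v else q k].

Lemma reveal_observe x q j : reveal x q j = observe q j (x j).
Proof. by apply/ffunP => k; rewrite !ffunE. Qed.

Lemma tested_observe q j v : tested (observe q j v) = j |: tested q.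
Proof. by apply/setP => k; rewrite !inE ffunE; case: (k =P j). Qed.

Lemma tested_costE q : tested_cost c q = \sum_(j in tested q) c j.
Proof. by apply: eq_bigl => j; rewrite inE. Qed.

Lemma tested_cost_observe q j v :
  q j = None -> tested_cost c (observe q j v) = c j + tested_cost c q.
Proof. by move=> qj; rewrite !tested_costE tested_observe big_setU1 //= inE qj. Qed.

Lemma consistent_upd x q j v :
  q j = None -> consistent (upd x j v) q = consistent x q.
Proof.
by move=> qj; apply: eq_forallb => k; rewrite ffunE; case: (k =P j) => // ->; rewrite qj.
Qed.

Lemma consistent_observe x q j v :
  q j = None -> consistent x (observe q j v) = consistent x q && (x j == v).
Proof.
move=> qj; apply/forallP/andP => [h|[/forallP h /eqP xj] k]; last first.
  by rewrite ffunE; case: (k =P j) => // ->; rewrite xj eqxx.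
split; last by have := h j; rewrite ffunE eqxx /= => /eqP[->].
by apply/forallP => k; have := h k; rewrite ffunE; case: (k =P j) => // ->; rewrite qj.
Qed.

Lemma consistent_empty x : consistent x (empty_partial n).
Proof. by apply/forallP => k; rewrite ffunE. Qed.

Variable S : strategy n.
Hypothesis S_valid : valid_strategy t B S.

Local Notation run := (run_strategy t B S).

(** Each step conducts a new test, and once none is left only [x] itself is consistent. *)
Lemma run_determined x k q : (#|~: tested q| <= k)%N -> consistent x q ->
  determined t B (run x k q) /\ consistent x (run x k q).
Proof.
elim: k q => [|k IH] q /= qk xq.
  split=> //; have qT j : q j != None.
    move: qk; rewrite leqn0 cards_eq0 => /eqP/setP/(_ j); rewrite !inE => /negbFE.
    by [].
  have cons_eq y : consistent y q -> y = x.
    move=> /forallP yq; apply/ffunP => j; have /forallP/(_ j) := xq; move: (yq j).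
    by case: (q j) (qT j) => //= v _ /eqP[<-] /eqP[<-].
  apply/forallP => y; apply/forallP => z; apply/implyP => /andP[/cons_eq -> /cons_eq ->].
  by apply/allP => i _; rewrite eqxx.
case: ifP => // /negbT qdet; have Sq := S_valid qdet; apply: IH; last first.
  by rewrite reveal_observe consistent_observe // xq eqxx.
rewrite reveal_observe tested_observe -ltnS; apply: leq_trans qk.
apply: proper_card; rewrite setCU properE; apply/andP; split; first exact: subsetIr.
by apply/subsetPn; exists (S q); rewrite !inE ?Sq ?eqxx.
Qed.

Variable L : seq 'I_n.
Hypotheses (L_uniq : uniq L) (L_full : forall j, j \in L).
Hypothesis L_sorted : pairwise (fun i j => c i / bias p s i <= c j / bias p s j) L.
Hypothesis goal_determined : forall x q, determined t B q -> consistent x q ->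
  (a <= hits s x setT < b)%N -> (a <= hits s x (tested q))%N.

Let rest A := [seq j <- L | j \notin A].

(** As a weight it ignores all tests outside [D] and [tested q], which insertion requires. *)
Definition live D q x : R := ((hits s x D < a)%N && consistent x q)%:R.

(* By induction along the run, the strategy continues greedily after its next test [j],
   and delaying [j] to its place in the greedy order is an insertion step. *)
Lemma adaptive_bound_from D k q :
  (forall x, (hits s x D < a)%N -> (hits s x setT < b)%N) ->
  (#|~: tested q| <= k)%N ->
  expectation p (fun x => in_class R s a b x * live D q x *
    goal_cost c s a (D :|: tested q) (rest (D :|: tested q)) x) <=
  expectation p (fun x => in_class R s a b x * live D q x *
    (tested_cost c (run x k q) - tested_cost c q)).
Proof.
move=> Db qk; pose w := live D; elim: k q qk => [|k IH] q qk.
  rewrite /= (_ : rest _ = [::]) /=.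
    by apply: ler_exp => // x; rewrite subrr.
  apply/eqP; rewrite -[_ == _]negbK -has_filter; apply/hasPn => j _; rewrite !inE negbK.
  move: qk; rewrite leqn0 cards_eq0 => /eqP/setP/(_ j); rewrite !inE => /negbFE ->.
  by rewrite orbT.
have [qdet|qdet] := boolP (determined t B q).
  (* When the strategy has stopped, its tests already reach the goal, so the greedy order pays
     nothing either. *)
  rewrite /= qdet; apply: ler_exp => // x; rewrite subrr mulr0 /in_class /w /live.
  case xab : (a <= _ < b)%N; last by rewrite !mul0r.
  case xq : (consistent x q); last by rewrite andbF mulr0 mul0r.
  rewrite goal_cost_reached ?mulr0 //.
  by apply: leq_trans (goal_determined qdet xq xab) _; apply: hits_sub; exact: subsetUr.
rewrite /= (negPf qdet); have := S_valid qdet; set j := S q => qj.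
(* At most one of the two extended observations is consistent with [x]. *)
have wS F x : w q x * F (x j) =
    w (observe q j true) x * F true + w (observe q j false) x * F false.
  rewrite /w /live !consistent_observe //.
  by case: (x j); rewrite ?andbT ?andbF ?mul0r ?addr0 ?add0r.
have qk' v : (#|~: tested (observe q j v)| <= k)%N.
  rewrite tested_observe -ltnS; apply: leq_trans qk.
  apply: proper_card; rewrite setCU properE; apply/andP; split; first exact: subsetIr.
  by apply/subsetPn; exists j; rewrite !inE ?qj ?eqxx.
set A := D :|: tested q; pose A' := D :|: (j |: tested q).
have {}IH v := IH _ (qk' v).
(* The middle term pays for [j] and is greedy afterwards. If [j] lies in [D], its result is known
   and [c j] is pure loss. *)
apply: le_trans (_ : expectation p (fun x => in_class R s a b x * w q x *
    (c j + goal_cost c s a A' (rest A') x)) <= _).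
  have wic_ge0 x : 0 <= in_class R s a b x * w q x by rewrite mulr_ge0 ?ler0n.
  have [jD|jD] := boolP (j \in D).
    have -> : A' = A by rewrite /A' setUCA; apply/setUidPr; rewrite sub1set inE jD.
    by apply: ler_exp => // x; rewrite ler_wpM2l // lerDr.
  have AA' : A' = j |: A by rewrite /A' setUCA.
  have jA : j \notin A by rewrite !inE negb_or jD qj.
  have AN i : i \in rest A -> i \notin A by rewrite mem_filter => /andP[].
  have rA' : rest A' = [seq i <- rest A | i != j].
    by rewrite -filter_predI; apply: eq_filter => i; rewrite /= AA' in_setU1 negb_or.
  have uA : uniq (rest A) by exact: filter_uniq.
  have sA : pairwise (fun i j => c i / bias p s i <= c j / bias p s j) (rest A).
    exact: subseq_pairwise (filter_subseq _ _) L_sorted.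
  have jr : j \in rest A by rewrite mem_filter jA L_full.
  rewrite rA' AA'; case/splitPr: jr uA sA AN => l1 l2.
  rewrite cat_uniq /= negb_or pairwise_cat /= -andbA.
  move=> /and4P[ul1 jl1 _ /andP[jl2 _]] /and3P[rl1 _ _] AN.
  have -> : [seq i <- l1 ++ j :: l2 | i != j] = l1 ++ l2.
    rewrite filter_cat /= eqxx; congr (_ ++ _); apply/all_filterP/allP => i il.
      by apply: contraNneq jl1 => <-.
    by apply: contraNneq jl2 => <-.
  have live_upd x v i : i \notin A -> w q (upd x i v) = w q x.
    rewrite !inE negb_or negbK => /andP[iD /eqP qi].
    by rewrite /w /live hits_upd // consistent_upd.
  apply: le_trans (_ : expectation p (fun x => in_class R s a b x * w q x *
     goal_cost c s a A (j :: l1 ++ l2) x) <= _); last first.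
    by apply: ler_exp => // x; rewrite ler_wpM2l //= lerD2r; case: ifP.
  apply: goal_cost_insert => //; last first.
    by move=> x v; exact: live_upd.
  move=> i il1; have iA : i \notin A by apply: AN; rewrite mem_cat il1.
  split=> //; first by apply: contraNneq jl1 => <-.
  - by move=> x v; exact: live_upd.
  - by have /allrelP := rl1; apply; rewrite ?inE ?eqxx.
  (* By [Db] the upper end of the class is no constraint while the weight is nonzero, so costs need
     not be compared. *)
  - right=> x; rewrite /w /live; case: (ltnP (hits s x D) a) => [/Db //|_].
    by rewrite eqxx.
pose G v x := in_class R s a b x * w (observe q j v) x.
have -> : expectation p (fun x => in_class R s a b x * w q x *
    (c j + goal_cost c s a A' (rest A') x)) =
  \sum_(v : bool) (expectation p (fun x => G v x * c j) +
    expectation p (fun x => G v x * goal_cost c s a A' (rest A') x)).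
  rewrite big_bool /= -!expD; apply: eq_exp => x.
  by rewrite -mulrA (wS (fun=> c j + goal_cost c s a A' (rest A') x)) /G; ring.
rewrite [leRHS](_ : _ = \sum_(v : bool) (expectation p (fun x => G v x * c j) +
    expectation p (fun x => G v x *
      (tested_cost c (run x k (observe q j v)) - tested_cost c (observe q j v))))).
  by apply: ler_sum => v _; rewrite lerD2l; have := IH v; rewrite tested_observe.
rewrite big_bool /= -!expD; apply: eq_exp => x.
rewrite -mulrA reveal_observe (wS (fun v => tested_cost c (run x k (observe q j v)) - _)) /G.
by rewrite !tested_cost_observe //; ring.
Qed.

Lemma adaptive_bound D :
  (forall x, (hits s x D < a)%N -> (hits s x setT < b)%N) ->
  expectation p (fun x => in_class R s a b x * goal_cost c s a D (rest D) x) <=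
  expectation p (fun x => in_class R s a b x *
    ((hits s x D < a)%N%:R * cost_strategy t B c S x)).
Proof.
move=> Db; have := @adaptive_bound_from D n (empty_partial n) Db.
have t0 : tested (empty_partial n) = set0 by apply/setP => j; rewrite !inE ffunE.
have c0 : tested_cost c (empty_partial n) = 0 by rewrite tested_costE t0 big_set0.
rewrite t0 setC0 cardsT card_ord setU0 => /(_ (leqnn n)).
under eq_exp => x.
  rewrite /live consistent_empty andbT -mulrA.
  rewrite (_ : _%:R * _ = goal_cost c s a D (rest D) x); first over.
  by case: ltnP => aD; rewrite ?mul1r // goal_cost_reached ?mulr0.
under [X in _ <= X -> _]eq_exp => x.
  rewrite /live consistent_empty andbT -mulrA c0 subr0; over.
by [].
Qed.

End Adaptive.

(** * Cost of a single goal within a score class *)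

Section GoalBound.
Variables (R : realFieldType) (n : nat) (c p : 'I_n -> R) (s : bool) (a b : nat).
Variables (t : nat -> nat) (B : nat).
Implicit Types (x : outcome n) (q : partial n) (A D : {set 'I_n}) (i j : 'I_n).
Hypothesis c_ge0 : forall j, 0 <= c j.
Hypothesis p01 : forall j, 0 < p j < 1.

(** Some test of [T] is not among the [k] cheapest and costs at least as much as the next one in
    [C]; remove it and induct. *)
Lemma cheapest_le (C : seq 'I_n) k (T : {set 'I_n}) : uniq C -> (forall j, j \in C) ->
  pairwise (fun i j => c i <= c j) C -> (k <= #|T|)%N ->
  \sum_(j <- take k C) c j <= \sum_(j in T) c j.
Proof.
move=> uC fC sC; elim: k T => [|k IH] T kT.
  by rewrite take0 big_nil sumr_ge0.
have : ~~ (T \subset take k C).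
  apply: contraL kT => /subset_leq_card; rewrite -leqNgt => /leq_trans; apply.
  by apply: leq_trans (card_size _) _; rewrite size_take; case: ltnP.
case/subsetPn=> e eT eD.
have kC : (k < size C)%N.
  by rewrite ltnNge; apply: contra eD => /take_oversize ->; exact: fC.
rewrite (take_nth e) // -cats1 big_cat big_seq1 (big_setD1 e) //= addrC.
apply: lerD; first exact: take_cheapest.
by apply: IH; move: kT; rewrite (cardsD1 e) eT.
Qed.

Variables (S : strategy n) (L C : seq 'I_n).
Hypothesis S_valid : valid_strategy t B S.
Hypotheses (L_uniq : uniq L) (L_full : forall j, j \in L).
Hypothesis L_sorted : pairwise (fun i j => c i / bias p s i <= c j / bias p s j) L.
Hypotheses (C_uniq : uniq C) (C_full : forall j, j \in C).
Hypothesis C_sorted : pairwise (fun i j => c i <= c j) C.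
Hypothesis goal_determined : forall x q, determined t B q -> consistent x q ->
  (a <= hits s x setT < b)%N -> (a <= hits s x (tested q))%N.
Hypothesis tests_determined : forall x q, determined t B q -> consistent x q ->
  (a <= hits s x setT < b)%N -> (n - (b - a) <= #|tested q|)%N.
Hypothesis ab : (a < b <= n.+1)%N.

(** The number [n - (b - a)] is the least one after which the goals of [a] hits and [n.+1 - b]
    misses cannot both be open. *)
Lemma goal_cost_bound :
  expectation p (fun x => in_class R s a b x * goal_cost c s a set0 L x) <=
  expectation p (fun x => in_class R s a b x *
    ((1 + (hits s x [set j in take (n - (b - a)) C] < a)%N%:R) * cost_strategy t B c S x)).
Proof.
set r := (n - (b - a))%N; set D := [set _ in _].
have cardD : #|D| = r.
  rewrite cardsE (card_uniqP (take_uniq _ C_uniq)) size_takel //.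
  have -> : size C = n.
    by rewrite -(card_uniqP C_uniq) -[RHS]card_ord; apply: eq_card => j; rewrite C_full.
  exact: leq_subr.
(* At most [b - a] tests lie outside [D], so fewer than [a] hits in [D] keep the total below [b]. *)
have Db x : (hits s x D < a)%N -> (hits s x setT < b)%N.
  move=> xD; have : (hits s x (~: D) <= n - r)%N.
    have <- : #|~: D| = (n - r)%N by rewrite cardsCs setCK cardD card_ord.
    by rewrite -(hitsN s x (~: D)) leq_addr.
  have : (hits s x setT <= hits s x D + hits s x (~: D))%N.
    rewrite -(setUCr D) /hits; apply: leq_trans (leq_card_setU _ _).
    by apply/subset_leq_card/subsetP => k; rewrite !inE -andb_orl.
  by move: ab; rewrite /r; lia.
have CL : C =i L by move=> j; rewrite C_full L_full.
apply: le_trans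
  (goal_cost_cheapest_first _ _ p01 r L_uniq C_uniq CL L_sorted C_sorted) _ => //.
under [leRHS]eq_exp do rewrite mulrDl mul1r mulrDr.
under eq_exp do rewrite goal_cost_cat set0U mulrDr.
(* The tests behind [D] are charged to the strategy by [adaptive_bound], those in [D] by
   [cheapest_le]. *)
rewrite !expD; apply: lerD; last first.
  have := adaptive_bound c_ge0 p01 S_valid L_uniq L_full L_sorted goal_determined Db.
  by congr (_ <= _); apply: eq_exp => x; congr (_ * goal_cost _ _ _ _ _ _);
    apply: eq_filter => j; rewrite inE.
apply: ler_exp => // x; rewrite /in_class; case xab: (a <= _ < b)%N; last by rewrite !mul0r.
rewrite !mul1r; apply: le_trans (goal_cost_le _ _ c_ge0 _ _ _) _.
rewrite /cost_strategy tested_costE; apply: cheapest_le => //.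
have [] := @run_determined _ _ _ _ S_valid x n (empty_partial n) _ (consistent_empty x).
  by rewrite -[n in leqRHS]card_ord max_card.
by move=> det xq; exact: tests_determined det xq xab.
Qed.

End GoalBound.

(** * Counters of the round robin scheme *)

Section RoundRobin.
Variables (R : realFieldType) (n : nat) (c : 'I_n -> R).
Variables (t : nat -> nat) (B : nat) (tb : partial n -> bool).
Implicit Types (x : outcome n) (q : partial n) (A : {set 'I_n}) (i j : 'I_n).
Implicit Types (l : seq 'I_n) (s : bool) (a : nat).
Hypothesis c_ge0 : forall j, 0 <= c j.

(** An upper bound for the counter of [l]: every test conducted for [l] precedes the first untested
    one, as may tests conducted for the other list. *)
Fixpoint tested_prefix q l : R :=
  if l is j :: l' then (if q j == None then 0 else c j + tested_prefix q l') else 0.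

Lemma tested_prefix_ge0 q l : 0 <= tested_prefix q l.
Proof. by elim: l => //= j l IH; case: ifP => // _; rewrite addr_ge0. Qed.

(** A goal still open under [q] was open before every test of the prefix and is open before [j], so
    the list alone pays for all of them. *)
Lemma tested_prefix_next_le s a A q l j x :
  ohead [seq j <- l | q j == None] = Some j -> A \subset tested q ->
  (hits s x (tested q) < a)%N -> tested_prefix q l + c j <= goal_cost c s a A l x.
Proof.
elim: l A => //= k l IH A + Aq qa.
have -> : (hits s x A < a)%N by apply: leq_ltn_trans qa; exact: hits_sub.
case: ifP => /= [_ [<-]|/negbT qk jl]; first by rewrite add0r lerDl goal_cost_ge0.
by rewrite -addrA lerD2l IH // subUset sub1set inE qk.
Qed.

Lemma tested_prefix_observe q l j v :
  tested_prefix q l <= tested_prefix (observe q j v) l.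
Proof.
elim: l => //= k l IH; rewrite ffunE; case: (k =P j) => [->|_] /=.
  by case: ifP => _; rewrite ?lerD2l // addr_ge0 ?tested_prefix_ge0.
by case: ifP => _; rewrite ?lerD2l.
Qed.

Lemma tested_prefix_next q l j v :
  ohead [seq j <- l | q j == None] = Some j ->
  tested_prefix q l + c j <= tested_prefix (observe q j v) l.
Proof.
elim: l => //= k l IH; rewrite ffunE.
case: ifP => /= [_ [->]|/negbT qk jl].
  by rewrite eqxx /= add0r lerDl tested_prefix_ge0.
rewrite -addrA; case: (k =P j) => [_|_] /=; first by rewrite lerD2l IH.
by rewrite (negPf qk) lerD2l IH.
Qed.

Lemma ohead_untested q l j : ohead [seq j <- l | q j == None] = Some j -> q j = None.
Proof. by elim: l => //= k l IH; case: ifP => //= /eqP qk [<-]. Qed.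

Lemma run_rr2_cost s1 s2 (f1 f2 : 'I_n -> 'I_n) a1 a2 x M :
  (forall q, consistent x q -> ~~ determined t B q ->
    (hits s1 x (tested q) < a1)%N \/ (hits s2 x (tested q) < a2)%N) ->
  goal_cost c s1 a1 set0 [seq f1 i | i <- enum 'I_n] x <= M ->
  goal_cost c s2 a2 set0 [seq f2 i | i <- enum 'I_n] x <= M ->
  tested_cost c (run_rr2 t B c f1 f2 tb x n (empty_partial n) 0 0) <= 2 * M.
Proof.
set L1 := map _ _; set L2 := map _ _ => und V1 V2.
have M0 : 0 <= M by apply: le_trans V1; exact: goal_cost_ge0.
(* Both counters staying below [M] is an invariant, valid for any number [k] of steps. *)
suff main k q C1 C2 : consistent x q ->
    C1 <= M -> C2 <= M -> C1 <= tested_prefix q L1 -> C2 <= tested_prefix q L2 ->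
    tested_cost c q <= C1 + C2 ->
    tested_cost c (run_rr2 t B c f1 f2 tb x k q C1 C2) <= 2 * M.
  apply: main; rewrite ?tested_prefix_ge0 ?consistent_empty //.
  by rewrite addr0 /tested_cost big1 // => j; rewrite ffunE.
elim: k q C1 C2 => [|k IH] q C1 C2 xq C1M C2M P1 P2 qC;
  have ? : tested_cost c q <= 2 * M by lra.
  by [].
rewrite /=; case: ifP => // /negbT qdet; rewrite /first_untested -/L1 -/L2.
case e1 : (ohead _) => [j1|//]; case e2 : (ohead _) => [j2|//].
have q1 := ohead_untested e1; have q2 := ohead_untested e2.
(* The list of an open goal can afford its next test. The scheme takes the smaller sum, which is
   then also at most [M], even if it belongs to the other list. *)
have least : C1 + c j1 <= M \/ C2 + c j2 <= M.
  case: (und q xq qdet) => h; [left; apply: le_trans V1|right; apply: le_trans V2].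
    by apply: le_trans (tested_prefix_next_le e1 (sub0set _) h); rewrite lerD2r.
  by apply: le_trans (tested_prefix_next_le e2 (sub0set _) h); rewrite lerD2r.
rewrite !divr1 !reveal_observe.
have cons j : q j = None -> consistent x (observe q j (x j)).
  by move=> qj; rewrite consistent_observe // xq eqxx.
have := tested_prefix_next (x j1) e1; have := tested_prefix_next (x j2) e2.
have := tested_prefix_observe q L1 j2 (x j2); have := tested_prefix_observe q L2 j1 (x j1).
move=> o1 o2 n1 n2.
have tc1 := tested_cost_observe c (x j1) q1; have tc2 := tested_cost_observe c (x j2) q2.
case: ifP => choice; apply: IH; rewrite ?cons ?tc1 ?tc2 //; lra.
Qed.

End RoundRobin.

(** * Score classes and when they are determined *)

Section Score.
Variables (n B : nat) (t : nat -> nat).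
Implicit Types (x : outcome n) (q : partial n).
Hypothesis t_lt : forall i : nat, (1 <= i <= B)%N -> (t i < t i.+1)%N.

Lemma thresholds_le i j : (0 < i)%N -> (i <= j <= B.+1)%N -> (t i <= t j)%N.
Proof.
move=> i0; elim: j => [|j IH]; first by lia.
case/andP; rewrite leq_eqVlt => /predU1P[-> //|ij] jB.
by apply: leq_trans (IH _) (ltnW (t_lt _)); lia.
Qed.

(** At most [t i.+1 - 1] successes means at least [n.+1 - t i.+1] failures, so stopping amounts to
    reaching two goals. *)
Lemma determinedP x q i : (1 <= i <= B)%N -> (t i <= ones x < t i.+1)%N ->
  (t B.+1 <= n.+1)%N -> consistent x q ->
  determined t B q =
  (t i <= hits true x (tested q))%N && (n.+1 - t i.+1 <= hits false x (tested q))%N.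
Proof.
move=> iB xi tB xq; have tin : (t i.+1 <= n.+1)%N.
  by apply: leq_trans tB; apply: thresholds_le; lia.
have cons_hits s y : consistent y q -> hits s y (tested q) = hits s x (tested q).
  move=> /forallP yq; apply: eq_hits => j; rewrite inE => qj; have /forallP/(_ j) := xq.
  by case: (q j) qj (yq j) => //= v _ /eqP[<-] /eqP[<-].
have onesE (y : outcome n) : (ones y + hits false y setT)%N = n.
  by rewrite -hits_ones (hitsN true) cardsT card_ord.
rewrite /determined; apply/forallP/andP => [det|[succ fail] y].
  (* The extreme completions: all untested tests fail in [lo] and succeed in [hi]. *)
  pose lo : outcome n := [ffun j => q j == Some true].
  pose hi : outcome n := [ffun j => q j != Some false].
  have lo_q : consistent lo q.
    by apply/forallP => j; rewrite ffunE; case: (q j) => [[]|].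
  have hi_q : consistent hi q.
    by apply/forallP => j; rewrite ffunE; case: (q j) => [[]|].
  have score y : consistent y q -> (t i <= ones y < t i.+1)%N.
    move=> yq; have /forallP/(_ y) := det x; rewrite xq yq /= => /allP/(_ i).
    by rewrite mem_iota xi addnC addn1 ltnS iB => /(_ isT) /eqP.
  split.
    rewrite -(cons_hits _ lo) //; have /andP[lo_i _] := score lo lo_q.
    apply: leq_trans lo_i _; rewrite -hits_ones; apply: subset_leq_card.
    by apply/subsetP => j; rewrite !inE ffunE eqb_id => /eqP ->.
  rewrite -(cons_hits _ hi) //; have /andP[_ hi_i] := score hi hi_q.
  have : (hits false hi setT <= hits false hi (tested q))%N.
    apply: subset_leq_card.
    by apply/subsetP => j; rewrite !inE ffunE eqbF_neg negbK => /eqP ->.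
  by have := onesE hi; lia.
apply/forallP => z; apply/implyP => /andP[yq zq].
have score u : consistent u q -> (t i <= ones u < t i.+1)%N.
  move=> uq; have h s : (hits s x (tested q) <= hits s u setT)%N.
    by rewrite -(cons_hits _ u) //; apply: hits_sub; exact: subsetT.
  by have := onesE u; have := h true; have := h false; rewrite hits_ones; lia.
have own k u : consistent u q -> (1 <= k <= B)%N -> (t k <= ones u < t k.+1)%N = (k == i).
  move=> /score ui kB; case: (ltngtP k i) => [ki|ik|-> //].
    by have := @thresholds_le k.+1 i isT; lia.
  by have := @thresholds_le i.+1 k isT; lia.
apply/allP => k; rewrite mem_iota => kB.
by rewrite !own //; lia.
Qed.

(** Each indicator is a difference of indicators of [u < t i.+1] and [u < t i], so the sum
    telescopes. *)
Lemma sum_score (R : nzRingType) (u : nat) : t 1%N = 0%N -> (u < t B.+1)%N ->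
  \sum_(1 <= i < B.+1) (t i <= u < t i.+1)%N%:R = 1 :> R.
Proof.
move=> t1 uB; rewrite (eq_big_nat _ _ (F2 := fun i => (u < t i.+1)%N%:R - (u < t i)%N%:R)).
  by rewrite telescope_sumr // uB t1 subr0.
move=> i iB; have := t_lt iB; case: (leqP (t i) u) => ui ti; first by rewrite subr0.
by rewrite (ltn_trans ui ti) subrr.
Qed.

End Score.

(** * Combining both goals on each score class *)

Theorem theorem2 (R : realFieldType) (n B : nat) (t : nat -> nat)
  (c p : 'I_n -> R) (sfail ssucc : {perm 'I_n})
  (tb : {ffun 'I_n -> option bool} -> bool)
  (OPT : {ffun 'I_n -> option bool} -> 'I_n) :
  (forall j, 0 <= c j) ->
  (forall j, 0 < p j < 1) ->
  t 1%N = 0%N ->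
  (forall i : nat, (1 <= i <= B)%N -> (t i < t i.+1)%N) ->
  t B.+1 = n.+1 ->
  sorted_by (fun j => c j / (1 - p j)) sfail ->
  sorted_by (fun j => c j / p j) ssucc ->
  valid_strategy t B OPT ->
  expectation p (cost_rr2 t B c sfail ssucc tb)
    <= 6 * expectation p (cost_strategy t B c OPT).
Proof.
move=> c_ge0 p01 t1 t_lt tB sort_fail sort_succ OPT_valid.
have onesE (x : outcome n) : (ones x + hits false x setT)%N = n.
  by rewrite -hits_ones (hitsN true) cardsT card_ord.
pose cls i (x : outcome n) : R := (t i <= ones x < t i.+1)%N%:R.
have by_class (F : outcome n -> R) :
    expectation p F = \sum_(1 <= i < B.+1) expectation p (fun x => cls i x * F x).
  rewrite -exp_sum; apply: eq_exp => x; rewrite -mulr_suml sum_score ?mul1r //.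
  by rewrite tB; have := onesE x; lia.
rewrite !by_class mulr_sumr; apply: ler_sum_nat => i iB.
have tin : (t i.+1 <= n.+1)%N by rewrite -tB; apply: (thresholds_le t_lt); lia.
have det (x : outcome n) q xi := @determinedP _ _ _ t_lt x q i iB xi.
pose C := sort (fun i j => c i <= c j) (enum 'I_n).
have C_sorted : pairwise (fun i j => c i <= c j) C.
  rewrite -sorted_pairwise; last by move=> ? ? ?; exact: le_trans.
  by apply: sort_sorted => ? ?; exact: le_total.
have C_uniq : uniq C by rewrite sort_uniq enum_uniq.
have C_full j : j \in C by rewrite mem_sort mem_enum.
have perm_uniq (f : {perm 'I_n}) : uniq [seq f k | k <- enum 'I_n].
  by rewrite map_inj_uniq ?enum_uniq //; exact: perm_inj.
have perm_full (f : {perm 'I_n}) j : j \in [seq f k | k <- enum 'I_n].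
  by apply/mapP; exists ((f^-1)%g j); rewrite ?mem_enum ?permKV.
have perm_sorted (r : 'I_n -> R) (f : {perm 'I_n}) : sorted_by r f ->
    pairwise (fun i j => r i <= r j) [seq f k | k <- enum 'I_n].
  move=> fr; rewrite pairwise_map; apply: (@sub_pairwise _ (relpre val leq)).
    by move=> k l; exact: fr.
  rewrite -pairwise_map val_enum_ord; apply/(pairwiseP 0%N) => k l.
  by rewrite !inE size_iota => kn ln kl; rewrite !nth_iota // ltnW.
set F := cost_strategy t B c OPT.
pose r := (n - (t i.+1 - t i))%N; pose D := [set j in take r C].
have card_tested (x : outcome n) (q : partial n) :
  (hits true x (tested q) + hits false x (tested q))%N = #|tested q|.
  exact: (hitsN true).
have ti := t_lt i iB.
have cls_true : in_class R true (t i) (t i.+1) =1 cls i.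
  by move=> x; rewrite /in_class hits_ones.
(* Counted in failures, the class is the mirrored interval of the same length, so both polarities
   share [r] and [D]. *)
have class_false (x : outcome n) :
    (n.+1 - t i.+1 <= hits false x setT < n.+1 - t i)%N = (t i <= ones x < t i.+1)%N.
  by have := onesE x; lia.
have cls_false : in_class R false (n.+1 - t i.+1) (n.+1 - t i) =1 cls i.
  by move=> x; rewrite /in_class class_false.
have rE : (n - (n.+1 - t i - (n.+1 - t i.+1)))%N = r by rewrite /r; lia.
have succ : expectation p (fun x => cls i x *
    goal_cost c true (t i) set0 [seq ssucc k | k <- enum 'I_n] x) <=
  expectation p (fun x => cls i x * ((1 + (hits true x D < t i)%N%:R) * F x)).
  under eq_exp do rewrite -cls_true; under [leRHS]eq_exp do rewrite -cls_true.
  apply: goal_cost_bound => //; last by rewrite ti.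
  - exact: perm_sorted.
  - by move=> x q + xq; rewrite hits_ones => + xi; rewrite (det x q xi) ?tB // => /andP[].
  - move=> x q + xq; rewrite hits_ones => + xi; rewrite (det x q xi) ?tB // -(card_tested x).
    by case/andP; lia.
have fail : expectation p (fun x => cls i x *
    goal_cost c false (n.+1 - t i.+1) set0 [seq sfail k | k <- enum 'I_n] x) <=
  expectation p (fun x => cls i x * ((1 + (hits false x D < n.+1 - t i.+1)%N%:R) * F x)).
  under eq_exp do rewrite -cls_false; under [leRHS]eq_exp do rewrite -cls_false.
  rewrite /D -rE; apply: goal_cost_bound => //; last by lia.
  - exact: perm_sorted.
  - by move=> x q + xq; rewrite class_false => + xi; rewrite (det x q xi) ?tB // => /andP[].
  - move=> x q + xq; rewrite class_false => + xi; rewrite (det x q xi) ?tB // -(card_tested x).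
    by case/andP; lia.
set V1 := goal_cost c true _ _ _ in succ; set V0 := goal_cost c false _ _ _ in fail.
have F_ge0 x : 0 <= F x by rewrite /F /cost_strategy /tested_cost sumr_ge0.
have cls_ge0 x : 0 <= cls i x by exact: ler0n.
apply: le_trans (_ : 2 * (expectation p (fun x => cls i x * V0 x) +
  expectation p (fun x => cls i x * V1 x)) <= _).
  rewrite -expD -expZ; apply: ler_exp => // x; rewrite /cls.
  case xi : (t i <= _ < _)%N; last by rewrite !mul0r addr0 mulr0.
  rewrite !mul1r.
  apply: (@run_rr2_cost _ _ _ _ _ _ c_ge0 false true _ _ (n.+1 - t i.+1) (t i)).
  - by move=> q xq; rewrite (det x q xi) ?tB // negb_and -!ltnNge => /orP[]; [right|left].
  - by rewrite lerDl goal_cost_ge0.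
  - by rewrite lerDr goal_cost_ge0.
have cardD : #|D| = r.
  rewrite cardsE (card_uniqP (take_uniq _ C_uniq)) size_takel //.
  by rewrite size_sort size_enum_ord leq_subr.
(* The 2 comes from the two counters, the 3 from the two goal bounds. *)
have -> : 6 = 2 * 3 :> R by rewrite -natrM.
rewrite -mulrA ler_wpM2l //.
apply: le_trans (lerD fail succ) _; rewrite -expD -expZ; apply: ler_exp => // x.
rewrite -mulrDr mulrCA ler_wpM2l // -mulrDl ler_wpM2r //.
(* The [r] tests of [D] cannot leave both goals open, so at most one of the two indicators is 1. *)
have := hitsN true x D; rewrite cardD /r.
case: (ltnP (hits true x D) _) => h1; case: (ltnP (hits false x D) _) => h0 /= hD; try lra.
by lia.
Qed.
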